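(* Assume $c\ne0$ and $m\ge4$. Let $(N^{m-1}(c),g)$ be an $(m-1)$-dimensional Riemannian space form and equip $\mathbb{R}\times N^{m-1}(c)$ with the Lorentzian metric $g_{\mathrm{prod}}=-dt^2+g$. Let $\alpha(s)$ be a $3$-Frenet helix in $N^{m-1}(c)$, parametrized by its arc length in $N^{m-1}(c)$, with curvatures $\kappa_\alpha,\tau_\alpha$. Let $\gamma$ be a $3$-Frenet curve in $(\mathbb{R}\times N^{m-1}(c),g_{\mathrm{prod}})$ of the type $$\gamma(s)=(d_1s,\alpha(d_2s)),$$ where the constants $d_1,d_2$ satisfy $\epsilon_1+d_1^2>0$ and $d_2=\sqrt{\epsilon_1+d_1^2}$, and assume that $$\epsilon_3\,(\tau_\alpha^2-\epsilon_1d_1^2\kappa_\alpha^2)>0.$$ Here $\epsilon_1,\epsilon_3$ are the signs associated with the Frenet frame of $\gamma$. Then $\gamma$ is a helix whose curvatures $\kappa,\tau$ do not verify $\epsilon_1\kappa^2+\epsilon_3\tau^2=0$. Moreover, for all $r\ge2$, $\gamma$ is proper $r$-harmonic in $(\mathbb{R}\times N^{m-1}(c),g_{\mathrm{prod}})$ if and only if $\alpha$ is proper $r$-harmonic in $N^{m-1}(c)$.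
   Context: Conventions. For a (semi-)Riemannian manifold $(M,\langle\,,\rangle)$ with Levi-Civita connection $\nabla$, $R(X,Y)Z=\nabla_X\nabla_YZ-\nabla_Y\nabla_XZ-\nabla_{[X,Y]}Z$. Curves are smooth, nonnull, parametrized by arc length on an open interval; $T=\gamma'$, $\langle T,T\rangle=\epsilon_1=\pm1$. Put $\nabla_T^0T=T$, $\nabla_T^jT=\nabla_T(\nabla_T^{j-1}T)$. For $r\ge2$, a curve is $r$-harmonic if $$\tau_r(\gamma)=\nabla^{2r-1}_T T+\sum_{\ell=0}^{r-2}(-1)^\ell R\big(\nabla^{2r-3-\ell}_T T,\nabla^{\ell}_T T\big)T=0,$$ and proper $r$-harmonic if it is $r$-harmonic and not a geodesic. A $3$-Frenet curve is a curve admitting a frame $\{F_1=T,F_2=N,F_3=B\}$ along it with $\langle F_i,F_i\rangle=\epsilon_i=\pm1$, $\langle F_i,F_j\rangle=0$ for $i\ne j$, and $\nabla_TT=\epsilon_2kN$, $\nabla_TN=-\epsilon_1kT+\epsilon_3\tau B$, $\nabla_TB=-\epsilon_2\tau N$, where the curvatures $k(s)$ and $\tau(s)$ are positive functions (if the ambient manifold is oriented of dimension $3$, $\tau$ is allowed to take any real value, $B$ being fixed by requiring the frame to be positively oriented). In a Riemannian manifold all $\epsilon_i=1$. It is a helix if the curvatures are constant. The Riemannian space form $N^{m-1}(c)$ has constant sectional curvature $c$: $R(X,Y)Z=c(g(Y,Z)X-g(X,Z)Y)$. *)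

(* Defs.v *)
From HB Require Import structures.
From mathcomp Require Import all_boot all_order all_algebra.
From mathcomp Require Import mathcomp_extra boolp classical_sets functions.
From mathcomp Require Import cardinality reals topology normedtype landau derive.

Set Implicit Arguments.
Unset Strict Implicit.
Unset Printing Implicit Defensive.

Import Order.TTheory GRing.Theory Num.Theory.
Import numFieldNormedType.Exports.

Local Open Scope classical_set_scope.
Local Open Scope ring_scope.

(* C^k regularity on an open set U of a finite-dimensional normed space. *)
Fixpoint Ck_on (R : realType) (V W : normedModType R) (k : nat)
    (U : set V) (f : V -> W) : Prop :=
  if k is k'.+1 then
    (forall x, U x -> differentiable f x) /\
    (forall v, Ck_on k' U (fun x => 'D_v f x))
  else forall x, U x -> {for x, continuous f}.

Definition smooth_on (R : realType) (V W : normedModType R)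
    (U : set V) (f : V -> W) : Prop := forall k, Ck_on k U f.

(* A smooth manifold modelled on R^n, given by an atlas (dom i, coord i) with
   inverse charts param i, together with a smooth nondegenerate symmetric metric
   tensor; metric i x is the Gram matrix of the coordinate frame of chart i at
   the point of coordinates x.  Tangent vectors are row vectors of components,
   so a change of chart acts by right multiplication by the Jacobian 'J. *)
Record semi_riemannian (R : realType) (n : nat) := SemiRiemannian {
  points :> topologicalType;
  chart : Type;
  dom : chart -> set points;
  coord : chart -> points -> 'rV[R]_n;
  param : chart -> 'rV[R]_n -> points;
  metric : chart -> 'rV[R]_n -> 'M[R]_n;
  points_hausdorff : hausdorff_space points;
  points_second_countable : @second_countable points;
  dom_open : forall i, open (dom i);
  dom_cover : forall p, exists i, dom i p;
  image_open : forall i, open (coord i @` dom i);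
  coordK : forall i p, dom i p -> param i (coord i p) = p;
  coord_cts : forall i p, dom i p -> {for p, continuous (coord i)};
  param_cts : forall i x,
    (coord i @` dom i) x -> {for x, continuous (param i)};
  transition_smooth : forall i j,
    smooth_on (coord i @` (dom i `&` dom j)) (coord j \o param i);
  metric_smooth : forall i, smooth_on (coord i @` dom i) (metric i);
  metric_sym : forall i x, (coord i @` dom i) x -> (metric i x)^T = metric i x;
  metric_unit : forall i x, (coord i @` dom i) x -> metric i x \in unitmx;
  metric_transition : forall i j p, dom i p -> dom j p ->
    metric i (coord i p) =
      'J (coord j \o param i) (coord i p) *m metric j (coord j p)
        *m ('J (coord j \o param i) (coord i p))^T
}.
Arguments dom {R n} s _ _.
Arguments coord {R n} s _ _.
Arguments param {R n} s _ _.
Arguments metric {R n} s _ _.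

Section Tensors.
Variables (R : realType) (n : nat) (M : semi_riemannian R n).
Implicit Types (i : chart M) (x u v w : 'rV[R]_n) (X Y Z : 'rV[R]_n -> 'rV[R]_n).

Definition inner i x u v : R := (u *m metric M i x *m v^T) 0 0.

Definition riemannian : Prop :=
  forall i x, (coord M i @` dom M i) x -> forall u, u != 0 -> 0 < inner i x u u.

(* Metric of signature (-, +, ..., +). *)
Definition lorentzian : Prop :=
  forall i x, (coord M i @` dom M i) x -> exists2 v, inner i x v v < 0 &
    forall u, u != 0 -> inner i x u v = 0 -> 0 < inner i x u u.

(* Componentwise derivative of a vector field of R^n in the direction v. *)
Definition dirder v Y x : 'rV[R]_n := \row_k 'D_v (fun y => Y y 0 k) x.

(* christoffel i x u v is the vector u^a v^b Gamma_ab^k of Levi-Civita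
   connection coefficients; the row koszul lists the inner products of this
   vector with the coordinate fields, as given by the Koszul formula. *)
Definition koszul i x u v : 'rV[R]_n := \row_k (2^-1 *
  ('D_u (fun y => inner i y v (delta_mx 0 k)) x
   + 'D_v (fun y => inner i y u (delta_mx 0 k)) x
   - 'D_(delta_mx 0 k) (fun y => inner i y u v) x)).

Definition christoffel i x u v : 'rV[R]_n := koszul i x u v *m invmx (metric M i x).

Definition nabla i X Y : 'rV[R]_n -> 'rV[R]_n :=
  fun x => dirder (X x) Y x + christoffel i x (X x) (Y x).

Definition lie_bracket X Y : 'rV[R]_n -> 'rV[R]_n :=
  fun x => dirder (X x) Y x - dirder (Y x) X x.

Definition curvature_fields i X Y Z : 'rV[R]_n -> 'rV[R]_n := fun x =>
  nabla i X (nabla i Y Z) x - nabla i Y (nabla i X Z) x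
  - nabla i (lie_bracket X Y) Z x.

(* R is a tensor, so its value on vectors is read off on any extensions; the
   ones used here have constant components in the chart. *)
Definition riem i x u v w : 'rV[R]_n := curvature_fields i (cst u) (cst v) (cst w) x.

Definition constant_curvature (c : R) : Prop :=
  forall i x, (coord M i @` dom M i) x -> forall u v w,
    riem i x u v w = c *: (inner i x v w *: u - inner i x u w *: v).

(* orient_sign i p is the sign of the coordinate frame of chart i at p. *)
Record orientation := Orientation {
  orient_sign : chart M -> M -> R;
  orient_sign_pm1 : forall i p, dom M i p ->
    orient_sign i p = 1 \/ orient_sign i p = -1;
  orient_sign_loc : forall i p, dom M i p ->
    \forall q \near p, orient_sign i q = orient_sign i p;
  orient_sign_transition : forall i j p, dom M i p -> dom M j p ->
    0 < orient_sign i p * orient_sign j p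
          * \det ('J (coord M j \o param M i) (coord M i p))
}.

End Tensors.

Section Curves.
Variables (R : realType) (n : nat) (M : semi_riemannian R n).
Implicit Types (J : set R) (gamma : R -> M) (i : chart M).

Definition open_interval J : Prop := [/\ open J, is_interval J & J !=set0].

Definition smooth_curve J gamma : Prop :=
  (forall s, J s -> {for s, continuous gamma}) /\
  forall i, smooth_on (J `&` gamma @^-1` dom M i) (coord M i \o gamma).

(* Components, in each chart, of a field of tangent vectors along a curve; the
   components in chart i are meaningful only at s with gamma s in dom M i. *)
Definition field_along : Type := chart M -> R -> 'rV[R]_n.

Definition smooth_field J gamma (V : field_along) : Prop :=
  (forall i j s, J s -> dom M i (gamma s) -> dom M j (gamma s) ->
    V j s = V i s *m 'J (coord M j \o param M i) (coord M i (gamma s))) /\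
  forall i, smooth_on (J `&` gamma @^-1` dom M i) (V i).

Definition velocity gamma : field_along :=
  fun i s => \row_k derive1 (fun t => coord M i (gamma t) 0 k) s.

Definition covariant_derivative gamma (V : field_along) : field_along :=
  fun i s => \row_k derive1 (fun t => V i t 0 k) s
    + christoffel i (coord M i (gamma s)) (velocity gamma i s) (V i s).

Definition nablaT gamma (j : nat) : field_along :=
  iter j (covariant_derivative gamma) (velocity gamma).

(* For r >= 2 none of the natural-number subtractions truncates. *)
Definition r_tension gamma (r : nat) : field_along := fun i s =>
  nablaT gamma (2 * r - 1)%N i s
  + \sum_(l < r.-1) (-1) ^+ l *:
      riem i (coord M i (gamma s)) (nablaT gamma (2 * r - 3 - l)%N i s)
        (nablaT gamma l i s) (velocity gamma i s).

Definition r_harmonic J gamma (r : nat) : Prop :=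
  forall i s, J s -> dom M i (gamma s) -> r_tension gamma r i s = 0.

Definition geodesic J gamma : Prop :=
  forall i s, J s -> dom M i (gamma s) -> nablaT gamma 1 i s = 0.

Definition proper_r_harmonic J gamma (r : nat) : Prop :=
  r_harmonic J gamma r /\ ~ geodesic J gamma.

Definition positively_oriented (o : orientation M) J gamma
    (F1 F2 F3 : field_along) : Prop :=
  forall i s, J s -> dom M i (gamma s) ->
    0 < orient_sign o i (gamma s)
          * \det (\matrix_(a < n) nth 0 [:: F1 i s; F2 i s; F3 i s] a).

(* The 3-Frenet curve gamma on J, parametrized by arc length, with frame
   (T, N, B), signs e1, e2, e3 and curvatures k, t.  Some o means that M is
   oriented by o, and None that M carries no orientation. *)
Record frenet3 (o : option (orientation M)) J gamma (e1 e2 e3 : R)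
    (N B : field_along) (k t : R -> R) : Prop := Frenet3 {
  frenet_interval : open_interval J;
  frenet_smooth : smooth_curve J gamma;
  frenet_N : smooth_field J gamma N;
  frenet_B : smooth_field J gamma B;
  frenet_signs : [/\ e1 = 1 \/ e1 = -1, e2 = 1 \/ e2 = -1 & e3 = 1 \/ e3 = -1];
  frenet_norm : forall i s, J s -> dom M i (gamma s) ->
    let g := inner i (coord M i (gamma s)) in
    let T := velocity gamma i s in
    [/\ g T T = e1, g (N i s) (N i s) = e2 & g (B i s) (B i s) = e3];
  frenet_orth : forall i s, J s -> dom M i (gamma s) ->
    let g := inner i (coord M i (gamma s)) in
    let T := velocity gamma i s in
    [/\ g T (N i s) = 0, g T (B i s) = 0 & g (N i s) (B i s) = 0];
  frenet_eqs : forall i s, J s -> dom M i (gamma s) ->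
    let T := velocity gamma in
    [/\ covariant_derivative gamma T i s = (e2 * k s) *: N i s,
        covariant_derivative gamma N i s
          = - (e1 * k s) *: T i s + (e3 * t s) *: B i s &
        covariant_derivative gamma B i s = - (e2 * t s) *: N i s];
  frenet_k : forall s, J s -> 0 < k s;
  frenet_t :
    if o is Some o' then
      if n == 3 then positively_oriented o' J gamma (velocity gamma) N B
      else forall s, J s -> 0 < t s
    else forall s, J s -> 0 < t s
}.

Definition helix J (k t : R -> R) : Prop :=
  exists k0 t0, forall s, J s -> k s = k0 /\ t s = t0.

End Curves.

Section ProductFacts.
Variable R : realType.

Lemma linear_mx_continuous (m n : nat) (W : normedModType R)
  (f : {linear 'M[R]_(m, n) -> W}) : continuous f.
Proof.
move=> A.
have sumC (I : Type) (r : seq I) (F : I -> 'M[R]_(m, n) -> W) :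
    (forall i, {for A, continuous (F i)}) ->
    {for A, continuous (fun B => \sum_(i <- r) F i B)}.
  move=> FC; elim: r => [|i r IH].
    have -> : (fun B => \sum_(i <- [::]) F i B) = cst 0.
      by apply/funext => B; rewrite big_nil.
    exact: cst_continuous.
  have -> : (fun B => \sum_(j <- i :: r) F j B) =
            F i + (fun B => \sum_(j <- r) F j B).
    by apply/funext => B; rewrite big_cons.
  exact: continuousD.
have -> : (f : 'M[R]_(m, n) -> W) = fun B =>
    \sum_(i < m) \sum_(j < n) B i j *: f (delta_mx i j).
  apply/funext => B; rewrite {1}[B]matrix_sum_delta linear_sum.
  by apply: eq_bigr => i _; rewrite linear_sum; apply: eq_bigr => j _; rewrite linearZ.
apply: (sumC) => i; apply: (sumC) => j.
apply: (@cvgZr_tmp _ _ _ (nbhs A)); exact: coord_continuous.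
Qed.

Lemma near_eq_differentiable (V W : normedModType R) (f g : V -> W) (x : V) :
  (\forall y \near x, f y = g y) -> differentiable g x ->
  differentiable f x /\ 'd f x = 'd g x :> (V -> W).
Proof.
move=> fg dg; have [dgc /eqaddoP gE] := (diff_locallyP _ _).1 dg.
have fE : f \o shift x = cst (f x) + 'd g x +o_ 0 id.
  apply/eqaddoP => e e0; have := gE e e0.
  have fgx : f x = g x by exact: nbhs_singleton fg.
  have fg0 : \forall h \near 0, f (h + x) = g (h + x).
    by have := fg; rewrite (near_shift 0) subr0.
  move=> ge; near=> h.
  have -> : (f \o shift x - (cst (f x) + 'd g x)) h =
            (g \o shift x - (cst (g x) + 'd g x)) h.
    by rewrite !fctE /= fgx; congr (_ - _); near: h.
  by near: h.
have dfg : 'd f x = 'd g x :> (V -> W) by exact: (diff_unique dgc fE).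
split; last exact: dfg.
by apply/diff_locallyP; rewrite dfg; exact: (conj dgc fE).
Unshelve. all: by end_near. Qed.

Lemma derive_comp_linear (V V' W : normedModType R) (f : V -> W)
  (L : {linear V' -> V}) (v x : V') : 'D_v (f \o L) x = 'D_(L v) f (L x).
Proof.
rewrite /derive.
have -> // : (fun h : R => h^-1 *: ((f \o L \o shift x) (h *: v) - (f \o L) x)) =
  (fun h : R => h^-1 *: ((f \o shift (L x)) (h *: L v) - f (L x))).
by apply/funext => h /=; rewrite [L (_ + _)]linearD [L (_ *: _)]linearZ.
Qed.

Lemma Ck_cst (V W : normedModType R) k (U : set V) (c : W) :
  Ck_on k U (cst c : V -> W).
Proof.
elim: k c => [|k IH] c /=; first by move=> x _; exact: cst_continuous.
split=> [x _|v]; first exact: differentiable_cst.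
have -> : (fun x : V => 'D_v (cst c) x) = cst 0; last exact: IH.
by apply/funext => x; exact: derive_cst.
Qed.

Lemma Ck_affine_comp (V V' W W' : normedModType R) (L : {linear V' -> V})
    (L1 : {linear W -> W'}) (L0 : {linear V' -> W'}) (c : W') k
    (U : set V) (f : V -> W) (g : V' -> W') :
  continuous L -> continuous L1 -> continuous L0 -> open U ->
  (forall x, U (L x) -> g x = c + L0 x + L1 (f (L x))) ->
  Ck_on k U f -> Ck_on k (L @^-1` U) g.
Proof.
move=> Lc L1c L0c oU; have oLU : open (L @^-1` U).
  by apply: open_comp => // x _; exact: Lc.
elim: k c L0 L0c f g => [|k IH] c L0 L0c f g gE /=.
  move=> fC x Ux.
  have gN : \forall y \near x, c + L0 y + L1 (f (L y)) = g y.
    have := open_nbhs_nbhs (conj oLU Ux); apply: filterS => y Uy.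
    by rewrite gE.
  rewrite /prop_for /continuous_at gE //.
  apply: (cvg_trans (near_eq_cvg gN)).
  apply: cvgD; first by apply: cvgD; [exact: cvg_cst|exact: L0c].
  apply: (@cvg_comp _ _ _ (f \o L) L1); last exact: L1c.
  by apply: (@cvg_comp _ _ _ L f); [exact: Lc|exact: fC].
move=> [fD fC].
have dcomp x : U (L x) -> differentiable (L1 \o (f \o L)) x.
  move=> Ux; apply: differentiable_comp; last exact: linear_differentiable.
  by apply: differentiable_comp; [exact: linear_differentiable|exact: fD].
have daff x : differentiable (cst c + (L0 : V' -> W')) x.
  by apply: differentiableD; [exact: differentiable_cst|exact: linear_differentiable].
have gN x : U (L x) ->
    \forall y \near x, g y = (cst c + (L0 : V' -> W') + (L1 \o (f \o L))) y.
  move=> Ux; have := open_nbhs_nbhs (conj oLU Ux); apply: filterS => y Uy.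
  by rewrite gE.
split=> [x Ux|v].
  apply: (near_eq_differentiable (gN x Ux) _).1.
  by apply: differentiableD; [exact: daff|exact: dcomp].
pose Z : {linear V' -> W'} := \0.
apply: (IH (L0 v) Z _ (fun y => 'D_(L v) f y)); last exact: fC.
  exact: cst_continuous.
move=> x Ux; rewrite (near_eq_derive _ (gN x Ux)).
have D1 : differentiable f (L x) by exact: fD.
have D2 : differentiable (f \o L) x.
  by apply: differentiable_comp; [exact: linear_differentiable|].
rewrite deriveD; [|exact/diff_derivable/daff|exact/diff_derivable/dcomp].
rewrite deriveD; [|exact/diff_derivable/differentiable_cst
                  |exact/diff_derivable/linear_differentiable].
rewrite derive_cst add0r addr0.
congr (_ + _).
  by rewrite deriveE ?diff_lin//; exact: linear_differentiable.
rewrite deriveE; last exact: dcomp.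
rewrite diff_comp//; last exact: linear_differentiable.
rewrite /= diff_lin//; congr (L1 _).
by rewrite -deriveE // derive_comp_linear.
Qed.

End ProductFacts.

(* R x M with the product topology, the charts (t, p) |-> (t, coord p) and the
   metric - dt^2 + g, g being the metric of M. *)
Section LorentzProduct.
Variables (R : realType) (n : nat) (M : semi_riemannian R n).

Definition prod_dom (i : chart M) : set (R * M) := [set p | dom M i p.2].

Definition prod_coord (i : chart M) (p : R * M) : 'rV[R]_(1 + n) :=
  row_mx p.1%:M (coord M i p.2).

Definition prod_param (i : chart M) (v : 'rV[R]_(1 + n)) : R * M :=
  (lsubmx v 0 0, param M i (rsubmx v)).

Definition prod_metric (i : chart M) (v : 'rV[R]_(1 + n)) : 'M[R]_(1 + n) :=
  block_mx (-1)%:M 0 0 (metric M i (rsubmx v)).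

Lemma prod_image (i j : chart M) :
  prod_coord i @` (prod_dom i `&` prod_dom j) =
  rsubmx @^-1` (coord M i @` (dom M i `&` dom M j)).
Proof.
apply/seteqP; split=> [_ [[t p] Mp <-]|v [p Mp pE]] /=.
  by exists p; rewrite // /prod_coord row_mxKr.
exists (lsubmx v 0 0, p) => //.
by rewrite /prod_coord /= pE -mx11_scalar hsubmxK.
Qed.

Lemma prod_image1 (i : chart M) :
  prod_coord i @` prod_dom i = rsubmx @^-1` (coord M i @` dom M i).
Proof. by have := prod_image i i; rewrite !setIid. Qed.

Lemma prod_hausdorff : hausdorff_space (R * M)%type.
Proof.
move=> [s p] [t q] pq; congr pair.
  apply: (@Rhausdorff R) => A B As Bt.
  have [] := pq (fst @^-1` A) (fst @^-1` B).
  - by exists (A, setT) => [|? []//]; split=> //; exact: filterT.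
  - by exists (B, setT) => [|? []//]; split=> //; exact: filterT.
  - by move=> x [? ?]; exists x.1.
apply: (@points_hausdorff _ _ M) => A B As Bt.
have [] := pq (snd @^-1` A) (snd @^-1` B).
- by exists (setT, A) => [|? []//]; split=> //; exact: filterT.
- by exists (setT, B) => [|? []//]; split=> //; exact: filterT.
- by move=> x [? ?]; exists x.2.
Qed.

Lemma prod_second_countable : @second_countable (R * M)%type.
Proof.
have [B Bc [Bo BE]] := @points_second_countable _ _ M.
pose I (q : rat * rat) : set R := `]ratr q.1, ratr q.2[%classic.
exists [set I z.1 `*` z.2 | z in [set: rat * rat] `*` B].
  apply: (sub_countable (card_image_le _ _)); by apply: countableX => //; exact: countableP.
split=> [_ [[q A] [_ /= BA] <-]|[t p] A [[/= C D] [Ct Dp] CDA]].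
  rewrite openE => -[s x] [/= Is Ax]; exists (I q, A) => //; split.
    by apply: open_nbhs_nbhs; split=> //; exact: interval_open.
  by apply: open_nbhs_nbhs; split=> //; exact: Bo.
have [E [BE' Ep] ED] := BE p D Dp.
have /nbhs_ballP[e /= e0 eC] := Ct.
have [q1 /[!in_itv]/= /andP[q1l q1r]] := @rat_in_itvoo R (t - e) t ltac:(by rewrite ltrBlDr ltrDl).
have [q2 /[!in_itv]/= /andP[q2l q2r]] := @rat_in_itvoo R t (t + e) ltac:(by rewrite ltrDl).
exists (I (q1, q2) `*` E).
  split; first by exists ((q1, q2), E).
  by split=> //; rewrite /I /= in_itv/= q1r q2l.
move=> [s x] [/= Is Ex]; apply: CDA; split=> /=; last exact: ED.
apply: eC; rewrite /ball /= ltr_distlC.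
move: Is; rewrite /I /= in_itv/= => /andP[h1 h2].
by rewrite (lt_trans q1l h1) (lt_trans h2 q2r).
Qed.

Lemma prod_dom_open i : open (prod_dom i).
Proof.
apply: (@open_comp _ _ snd); last exact: dom_open.
by move=> x _; exact: cvg_snd.
Qed.

Lemma prod_dom_cover p : exists i, prod_dom i p.
Proof. by have [i ip] := dom_cover p.2; exists i. Qed.

Lemma prod_image_open i : open (prod_coord i @` prod_dom i).
Proof.
rewrite prod_image1; apply: open_comp; last exact: image_open.
by move=> x _; exact: continuous_rsubmx.
Qed.

Lemma prod_coordK i p : prod_dom i p -> prod_param i (prod_coord i p) = p.
Proof.
move=> ip; rewrite /prod_param /prod_coord row_mxKl row_mxKr coordK//.
by rewrite mxE eqxx mulr1n -surjective_pairing.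
Qed.

Definition embl : {linear 'rV[R]_1 -> 'rV[R]_(1 + n)} := mulmxr (row_mx 1%:M 0).
Definition embr : {linear 'rV[R]_n -> 'rV[R]_(1 + n)} := mulmxr (row_mx 0 1%:M).

Lemma row_mx_emb (a : 'rV[R]_1) (b : 'rV[R]_n) : row_mx a b = embl a + embr b.
Proof. by rewrite /= !mul_mx_row !mulmx1 !mulmx0 add_row_mx addr0 add0r. Qed.

Lemma scalar11_emb (t : R) : t%:M = t *: 1%:M :> 'rV[R]_1.
Proof. by rewrite scale_scalar_mx mulr1. Qed.

Lemma prod_coord_cts i p : prod_dom i p -> {for p, continuous (prod_coord i)}.
Proof.
move=> ip.
have -> : prod_coord i = fun p => p.1 *: embl 1%:M + embr (coord M i p.2).
  apply/funext => q.
  by rewrite /prod_coord row_mx_emb scalar11_emb linearZ.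
rewrite /prop_for /continuous_at; apply: cvgD.
  by apply: (@cvgZr_tmp _ _ _ (nbhs p)); exact: cvg_fst.
apply: (@cvg_comp _ _ _ (coord M i \o snd) embr); last exact: linear_mx_continuous.
apply: (@cvg_comp _ _ _ snd (coord M i)); last exact: coord_cts.
exact: cvg_snd.
Qed.

Lemma prod_param_cts i x :
  (prod_coord i @` prod_dom i) x -> {for x, continuous (prod_param i)}.
Proof.
rewrite prod_image1 => ix.
have c1 : (lsubmx v 0 0 : R) @[v --> x] --> (lsubmx x 0 0 : R).
  apply: (@cvg_comp _ _ _ lsubmx (fun a : 'rV[R]_1 => a 0 0)).
    exact: continuous_lsubmx.
  exact: coord_continuous.
have c2 : param M i (rsubmx v) @[v --> x] --> param M i (rsubmx x).
  apply: (@cvg_comp _ _ _ rsubmx (param M i)); last exact: param_cts.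
  exact: continuous_rsubmx.
exact: (cvg_pair c1 c2).
Qed.

Lemma prod_transitionE i j v : (prod_coord j \o prod_param i) v =
  embl (lsubmx v) + embr ((coord M j \o param M i) (rsubmx v)).
Proof.
by rewrite /= /prod_coord /prod_param /= -[_%:M]mx11_scalar row_mx_emb.
Qed.

Lemma image_open2 (i j : chart M) : open (coord M i @` (dom M i `&` dom M j)).
Proof.
rewrite openE => _ [p [ip jp] <-]; rewrite /interior.
have ipi : (coord M i @` dom M i) (coord M i p) by exists p.
have jN : nbhs (coord M i p) (param M i @^-1` dom M j).
  apply: (param_cts ipi); rewrite coordK//.
  by apply: open_nbhs_nbhs; split=> //; exact: dom_open.
have iN : nbhs (coord M i p) (coord M i @` dom M i).
  by apply: open_nbhs_nbhs; split=> //; exact: image_open.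
apply: filterS (filterI iN jN) => _ [[q iq <-]] /=.
by rewrite coordK// => jq; exists q.
Qed.

Lemma prod_transition_smooth i j :
  smooth_on (prod_coord i @` (prod_dom i `&` prod_dom j))
    (prod_coord j \o prod_param i).
Proof.
move=> k; rewrite prod_image.
pose L0 : {linear 'rV[R]_(1 + n) -> 'rV[R]_(1 + n)} := embl \o lsubmx.
apply: (@Ck_affine_comp R _ _ _ _ rsubmx embr L0 0 k _ (coord M j \o param M i)).
- exact: continuous_rsubmx.
- exact: linear_mx_continuous.
- exact: linear_mx_continuous.
- exact: image_open2.
- by move=> v _; rewrite add0r prod_transitionE.
- exact: transition_smooth.
Qed.

Lemma prod_metric_smooth i :
  smooth_on (prod_coord i @` prod_dom i) (prod_metric i).
Proof.
move=> k; rewrite prod_image1.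
pose L1 : {linear 'M[R]_n -> 'M[R]_(1 + n)} :=
  mulmxr (row_mx 0 1%:M : 'M_(n, 1 + n)) \o mulmx (col_mx 0 1%:M : 'M_(1 + n, n)).
pose L0 : {linear 'rV[R]_(1 + n) -> 'M[R]_(1 + n)} := \0.
apply: (@Ck_affine_comp R _ _ _ _ rsubmx L1 L0 (block_mx (-1)%:M 0 0 0) k _
  (metric M i)).
- exact: continuous_rsubmx.
- exact: linear_mx_continuous.
- exact: linear_mx_continuous.
- exact: image_open.
- move=> v _; rewrite /prod_metric /L0 /= addr0 mul_col_mx mul0mx mul1mx.
  rewrite mul_col_row !(mul0mx, mulmx0, mulmx1).
  by rewrite add_block_mx !addr0 !add0r.
- exact: metric_smooth.
Qed.

Lemma prod_metric_sym i x :
  (prod_coord i @` prod_dom i) x -> (prod_metric i x)^T = prod_metric i x.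
Proof.
rewrite prod_image1 => ix.
by rewrite /prod_metric tr_block_mx tr_scalar_mx !trmx0 metric_sym.
Qed.

Lemma prod_metric_unit i x :
  (prod_coord i @` prod_dom i) x -> prod_metric i x \in unitmx.
Proof.
rewrite prod_image1 => ix; rewrite unitmxE det_ublock unitrM det_scalar expr1.
by rewrite unitrN1 -unitmxE metric_unit.
Qed.

Lemma prod_jacobian i j p : prod_dom i p -> prod_dom j p ->
  'J (prod_coord j \o prod_param i) (prod_coord i p) =
  block_mx 1%:M 0 0 ('J (coord M j \o param M i) (coord M i p.2)).
Proof.
move=> ip jp; set f := coord M j \o param M i.
have df : differentiable f (rsubmx (prod_coord i p)).
  rewrite row_mxKr; have [+ _] := @transition_smooth _ _ M i j 1%N.
  by apply; exists p.2.
have fE : prod_coord j \o prod_param i = (embl \o lsubmx) + (embr \o (f \o rsubmx)).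
  by apply/funext => v; rewrite prod_transitionE.
have dl : differentiable (embl \o lsubmx) (prod_coord i p).
  by apply: linear_differentiable; exact: linear_mx_continuous.
have dfr : differentiable (f \o rsubmx) (prod_coord i p).
  by apply: differentiable_comp => //; exact: differentiable_rsubmx.
have der : differentiable embr (f (rsubmx (prod_coord i p))).
  by apply: linear_differentiable; exact: linear_mx_continuous.
have dr : differentiable (embr \o (f \o rsubmx)) (prod_coord i p).
  exact: differentiable_comp.
have hl w : 'd (embl \o lsubmx) (prod_coord i p) w = embl (lsubmx w).
  rewrite diff_comp//; [|exact: differentiable_lsubmx
                        |by apply: linear_differentiable; exact: linear_mx_continuous].
  rewrite /comp diff_lin; last exact: linear_mx_continuous.
  by rewrite diff_lin//; exact: continuous_lsubmx.
have hr w : 'd (embr \o (f \o rsubmx)) (prod_coord i p) w =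
          embr ('d f (coord M i p.2) (rsubmx w)).
  rewrite diff_comp// diff_comp//; last exact: differentiable_rsubmx.
  rewrite /comp [rsubmx (prod_coord i p)]row_mxKr diff_lin; last exact: linear_mx_continuous.
  by rewrite diff_lin//; exact: continuous_rsubmx.
have hd w : 'd (prod_coord j \o prod_param i) (prod_coord i p) w =
            embl (lsubmx w) + embr ('d f (coord M i p.2) (rsubmx w)).
  have := diffD dl dr; rewrite -fE => /(congr1 (fun h => h w)) ->.
  by rewrite -hl -hr.
apply/row_matrixP => k; rewrite !rowE; set v := 'e_k.
rewrite /jacobian mul_rV_lin1 hd -row_mx_emb -[in RHS](hsubmxK v).
by rewrite mul_row_block !mulmx0 addr0 add0r mulmx1 mul_rV_lin1.
Qed.

Lemma prod_metric_transition i j p : prod_dom i p -> prod_dom j p ->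
  prod_metric i (prod_coord i p) =
    'J (prod_coord j \o prod_param i) (prod_coord i p)
      *m prod_metric j (prod_coord j p)
      *m ('J (prod_coord j \o prod_param i) (prod_coord i p))^T.
Proof.
move=> ip jp; rewrite prod_jacobian// /prod_metric !row_mxKr.
rewrite tr_block_mx !trmx0 trmx1 !mulmx_block.
rewrite !(mulmx0, mul0mx, mulmx1, mul1mx, addr0, add0r).
by rewrite (metric_transition ip jp).
Qed.

Definition lorentz_product : semi_riemannian R (1 + n) :=
  SemiRiemannian prod_hausdorff prod_second_countable prod_dom_open
    prod_dom_cover prod_image_open prod_coordK prod_coord_cts prod_param_cts
    prod_transition_smooth prod_metric_smooth prod_metric_sym prod_metric_unit
    prod_metric_transition.

Lemma lorentz_product_lorentzian : riemannian M -> lorentzian lorentz_product.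
Proof.
move=> Mpos i x.
rewrite (prod_image1 i : coord lorentz_product i @` dom lorentz_product i = _) => ix.
have innerE (u v : 'rV[R]_(1 + n)) : inner (M := lorentz_product) i x u v =
    - (lsubmx u 0 0 * lsubmx v 0 0) + inner (M := M) i (rsubmx x) (rsubmx u) (rsubmx v).
  rewrite /inner /= /prod_metric -{1}(hsubmxK u) -{1}(hsubmxK v).
  rewrite mul_row_block !mulmx0 addr0 add0r tr_row_mx mul_row_col.
  rewrite mxE mul_mx_scalar; congr (_ + _).
  by rewrite mxE big_ord1 !mxE mulN1r mulNr.
exists (row_mx 1%:M 0).
  rewrite innerE row_mxKl row_mxKr /inner mul0mx mul0mx !mxE addr0.
  by rewrite mulr1 oppr_lt0.
move=> u u0; rewrite !innerE row_mxKl row_mxKr.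
have -> : inner (M := M) i (rsubmx x) (rsubmx u) 0 = 0 by rewrite /inner trmx0 mulmx0 mxE.
rewrite addr0 [_%:M 0 0]mxE eqxx mulr1 => /eqP; rewrite oppr_eq0 => /eqP ul.
rewrite ul mul0r oppr0 add0r; apply: Mpos => //.
apply: contra_neq u0 => ur; rewrite -[u]hsubmxK ur.
by rewrite [lsubmx u]mx11_scalar ul raddf0 row_mx0.
Qed.
End LorentzProduct.

(* Main.v *)
(* In a chart of R x M nothing depends on the time coordinate, so the
   Christoffel symbols and the curvature have no time component and are those
   of M on the spatial parts.  Along gamma(s) = (d1 s, alpha(d2 s)) this gives
   nabla^j T = (0, d2^(j+1) nabla^j T_alpha) for j >= 1, and every term of the
   r-tension field picks up the same factor d2^(2r):
   tau_r(gamma)(s) = (0, d2^(2r) tau_r(alpha)(d2 s)).  Likewise the Frenet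
   equations of alpha force e2 = 1, k = d2^2 kalpha and
   t^2 = d2^2 e3 (talpha^2 - e1 d1^2 kalpha^2), whence
   e1 k^2 + e3 t^2 = d2^2 (kalpha^2 + talpha^2) > 0. *)
Require Import Defs.
From mathcomp Require Import all_boot all_order all_algebra.
From mathcomp Require Import boolp classical_sets functions reals topology.
From mathcomp Require Import normedtype derive.
From mathcomp Require Import zify ring lra.

Set Implicit Arguments.
Unset Strict Implicit.
Unset Printing Implicit Defensive.

Import Order.TTheory GRing.Theory Num.Theory.
Import numFieldNormedType.Exports.
Local Open Scope classical_set_scope.
Local Open Scope ring_scope.

(** * Directional derivatives under rescaling, projection and addition of constants *)

Section DerivativeScaling.
Variable R : realType.

(** Multiplications by [a] and [a^-1] both preserve the punctured neighbourhoods of 0, so the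
    filters coincide; this permits the substitution of [h * a] for [h] in any difference
    quotient. *)
Lemma dnbhs0_mulr (a : R) : a != 0 -> (h * a @[h --> (0 : R)^']) = (0 : R)^'.
Proof.
have sub (b : R) : b != 0 -> (h * b @[h --> (0 : R)^']) --> (0 : R)^'.
  move=> b0 A; rewrite /dnbhs /within /= => A0.
  have : (h * b) @[h --> (0 : R)] --> (0 : R).
    by rewrite -[X in _ --> X](mul0r b); apply: cvgMl.
  move=> /(_ _ A0); apply: (@filterS _ (nbhs (0 : R))) => h /=.
  by rewrite mulf_eq0 negb_or b0 andbT.
move=> a0; apply/seteqP; split=> A; last exact: sub.
move=> Aa; have := sub a^-1; rewrite invr_eq0 => /(_ a0 _ Aa).
by rewrite /nbhs /=; apply: filterS => h /=; rewrite mulfVK.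
Qed.

(* True even where [f] has no derivative: ['D] is then the junk value 0, which
   is fixed by scaling. *)
Lemma derive_scale (V : normedModType R) (f : V -> R) (a b : R) (v x : V) :
  'D_(a *: v) (fun y => b * f y) x = a * b * 'D_v f x.
Proof.
have [->|a0] := eqVneq a 0; first by rewrite scale0r derive0 !mul0r.
have [->|b0] := eqVneq b 0.
  have -> : (fun y => 0 * f y) = cst 0 by apply/funext => y; rewrite mul0r.
  by rewrite derive_cst mulr0 mul0r.
pose q (h : R) : R := h^-1 * (f (h *: v + x) - f x).
have qE : (fun h : R => h^-1 *: (((fun y => b * f y) \o shift x) (h *: (a *: v))
      - b * f x)) = (fun h => (a * b) * q (h * a)).
  apply/funext => h; rewrite /q /= scalerA -mulrBr /GRing.scale /=.
  (* At [h = 0] both sides vanish, since [0^-1 = 0]. *)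
  rewrite invfM; have [->|h0] := eqVneq h 0; first by rewrite invr0 !(mul0r, mulr0).
  by field; rewrite a0.
rewrite /derive qE.
have -> : ((a * b * q (h * a)) @[h --> (0 : R)^']) = ((a * b * q h) @[h --> (0 : R)^']).
  by rewrite -[in RHS](@dnbhs0_mulr a).
have ab0 : a * b != 0 by rewrite mulf_neq0.
have [qc|qd] := pselect (cvg (q h @[h --> (0 : R)^'])).
  by apply/cvg_lim => //; apply: cvgMr; exact: qc.
rewrite (dvgP qd) dvgP ?mulr0// => abq; apply: qd.
have -> : q = fun h => (a * b)^-1 * (a * b * q h).
  by apply/funext => h; rewrite mulKf.
by apply: is_cvgMr.
Qed.

(** The inner factor [a] is read as the direction [a *: 1] at [a * s], which reduces the claim to
    [derive_scale]. *)
Lemma derive1_scale (f : R -> R) (a b s : R) :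
  derive1 (fun t => b * f (a * t)) s = a * b * derive1 f (a * s).
Proof.
have dqE : (fun h : R => h^-1 *: (b * f (a * (h + s)) - b * f (a * s))) =
    (fun h => h^-1 *: (((fun y => b * f y) \o shift (a * s)) (h *: (a *: 1))
      - b * f (a * s))).
  by apply/funext => h /=; rewrite /GRing.scale /= mulr1 (mulrDr a) (mulrC a h).
by rewrite [in RHS]derive1E -derive_scale /derive1 dqE.
Qed.

Lemma derive_comp_rsubmx (n : nat) (f : 'rV[R]_n -> R) (v x : 'rV[R]_(1 + n)) :
  'D_v (fun y => f (rsubmx y)) x = 'D_(rsubmx v) f (rsubmx x).
Proof. exact: (derive_comp_linear f rsubmx). Qed.

Lemma derive_addl_cst (V : normedModType R) (c : R) (f : V -> R) (v x : V) :
  'D_v (fun y => c + f y) x = 'D_v f x.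
Proof.
rewrite /derive.
have -> // : (fun h : R => h^-1 *: (((fun y => c + f y) \o shift x) (h *: v) - (c + f x)))
  = (fun h => h^-1 *: ((f \o shift x) (h *: v) - f x)).
by apply/funext => h /=; rewrite opprD addrACA subrr add0r.
Qed.

End DerivativeScaling.

(** * Homogeneity of metric, connection and curvature *)

Section Scaling.
Variables (R : realType) (n : nat) (M : semi_riemannian R n).
Implicit Types (i : chart M) (x u v w : 'rV[R]_n) (X Y Z : 'rV[R]_n -> 'rV[R]_n).

Lemma inner_scale i x a b u v :
  inner i x (a *: u) (b *: v) = a * b * inner i x u v.
Proof.
by rewrite /inner linearZ /= -!scalemxAl -scalemxAr scalerA !mxE.
Qed.

Lemma innerDl i x u v w : inner i x (u + v) w = inner i x u w + inner i x v w.
Proof. by rewrite /inner !mulmxDl mxE. Qed.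

Lemma innerDr i x u v w : inner i x u (v + w) = inner i x u v + inner i x u w.
Proof. by rewrite /inner linearD /= mulmxDr mxE. Qed.

Lemma inner0r i x u : inner i x u 0 = 0.
Proof. by rewrite /inner trmx0 mulmx0 mxE. Qed.

Lemma innerC i x u v : (Defs.coord M i @` dom M i) x -> inner i x u v = inner i x v u.
Proof.
move=> ix; rewrite /inner.
have -> : v *m metric M i x *m u^T = (u *m metric M i x *m v^T)^T.
  by rewrite !trmx_mul trmxK Defs.metric_sym// mulmxA.
by rewrite [in RHS]mxE.
Qed.

Lemma christoffel_scale i x a b u v :
  christoffel i x (a *: u) (b *: v) = (a * b) *: christoffel i x u v.
Proof.
rewrite /christoffel scalemxAl; congr (_ *m _).
apply/rowP => k; rewrite !mxE.
have innerE a' b' u' v' : (fun y => inner i y (a' *: u') (b' *: v')) =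
    (fun y => a' * b' * inner i y u' v').
  by apply/funext => y; exact: inner_scale.
(* With the coordinate vector written as a multiple by 1, [inner_scale] and [derive_scale] fit all
   three Koszul terms. *)
rewrite -(scale1r (delta_mx 0 k)) !innerE !derive_scale scale1r.
by ring.
Qed.

Lemma dirder_scale a b v Y x :
  dirder (a *: v) (fun y => b *: Y y) x = (a * b) *: dirder v Y x.
Proof.
apply/rowP => k; rewrite !mxE -derive_scale.
by under eq_fun do rewrite mxE.
Qed.

Lemma nabla_scale i a b X Y x :
  nabla i (fun y => a *: X y) (fun y => b *: Y y) x = (a * b) *: nabla i X Y x.
Proof. by rewrite /nabla dirder_scale christoffel_scale scalerDr. Qed.

Lemma dirder_cst v u x : dirder v (cst u) x = 0.
Proof. by apply/rowP => k; rewrite !mxE derive_cst. Qed.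

Lemma lie_bracket_cst u v : lie_bracket (cst u) (cst v) = cst 0.
Proof. by apply/funext => x; rewrite /lie_bracket !dirder_cst subr0. Qed.

Lemma riem_scale i x a b c u v w :
  riem i x (a *: u) (b *: v) (c *: w) = (a * b * c) *: riem i x u v w.
Proof.
have nablaC a' b' u' w' : nabla i (cst (a' *: u')) (cst (b' *: w')) =
    fun y => (a' * b') *: nabla i (cst u') (cst w') y.
  by apply/funext => y; rewrite -(nabla_scale i a' b' (cst u') (cst w')).
rewrite /riem /curvature_fields !lie_bracket_cst !nablaC !scalerBr.
rewrite (nabla_scale i a _ (cst u)) (nabla_scale i b _ (cst v)).
(* The zero bracket is written as [(a * b) *: 0] so that its term scales like the other two. *)
rewrite -[cst 0]/(cst (0 : 'rV[R]_n)) -{1}(scaler0 _ (a * b)) nablaC.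
by rewrite !mulrA [b * a]mulrC.
Qed.

End Scaling.

(** * Connection and curvature of the Lorentzian product *)

Section ProductGeometry.
Variables (R : realType) (n : nat) (M : semi_riemannian R n).
Let P := lorentz_product M.
Implicit Types (i : chart M) (x u v w : 'rV[R]_(1 + n)).

Lemma inner_product i x u v : inner (i : chart P) x u v =
  - (lsubmx u 0 0 * lsubmx v 0 0) + inner i (rsubmx x) (rsubmx u) (rsubmx v).
Proof.
rewrite /inner /= /prod_metric -{1}(hsubmxK u) -{1}(hsubmxK v).
rewrite mul_row_block !mulmx0 addr0 add0r tr_row_mx mul_row_col.
rewrite mxE mul_mx_scalar; congr (_ + _).
by rewrite mxE big_ord1 !mxE mulN1r mulNr.
Qed.

Lemma derive_inner_product i w u v x :
  'D_w (fun y => inner (i : chart P) y u v) x =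
  'D_(rsubmx w) (fun y => inner i y (rsubmx u) (rsubmx v)) (rsubmx x).
Proof.
under eq_fun do rewrite inner_product.
rewrite derive_addl_cst.
exact: (derive_comp_rsubmx (fun y => inner i y (rsubmx u) (rsubmx v))).
Qed.

Lemma koszul_product i x u v : koszul (i : chart P) x u v =
  row_mx 0 (koszul i (rsubmx x) (rsubmx u) (rsubmx v)).
Proof.
apply/rowP => k; rewrite mxE !derive_inner_product.
case: (split_ordP k) => j ->.
  (* The time direction has zero spatial part, so all three Koszul terms vanish. *)
  have -> : rsubmx (delta_mx 0 (lshift n j) : 'rV[R]_(1 + n)) = 0.
    by apply/rowP => l; rewrite !mxE eq_rlshift andbF.
  have inner0 (u' : 'rV[R]_n) : (fun y => inner i y u' 0) = cst 0.
    by apply/funext => y; exact: inner0r.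
  by rewrite !inner0 !derive_cst derive0 row_mxEl !mxE; ring.
have -> : rsubmx (delta_mx 0 (rshift 1 j) : 'rV[R]_(1 + n)) = delta_mx 0 j.
  by apply/rowP => l; rewrite !mxE eq_rshift.
by rewrite row_mxEr mxE.
Qed.

Lemma invmx_prod_metric i x : invmx (prod_metric i x) =
  block_mx (-1)%:M 0 0 (invmx (metric M i (rsubmx x))).
Proof.
have unitE : (prod_metric i x \in unitmx) = (metric M i (rsubmx x) \in unitmx).
  by rewrite !unitmxE det_ublock det_scalar expr1 mulN1r unitrN.
have [gP|gP] := boolP (prod_metric i x \in unitmx); last first.
  (* On a singular matrix [invmx] is the identity; the product metric and its spatial block are
     singular together, so the formula persists. *)
  by rewrite !invmx_out // !inE /= -?unitE.
apply: (can_inj (mulKmx gP)); rewrite mulmxV// mulmx_block.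
rewrite !(mulmx0, mul0mx, addr0, add0r) mulmxV -?unitE//.
by rewrite -scalar_mxM mulrNN mulr1 -scalar_mx_block.
Qed.

Lemma christoffel_product i x u v : christoffel (i : chart P) x u v =
  row_mx 0 (christoffel i (rsubmx x) (rsubmx u) (rsubmx v)).
Proof.
rewrite /christoffel koszul_product [invmx _]invmx_prod_metric.
by rewrite mul_row_block !(mulmx0, mul0mx, add0r, addr0).
Qed.

Lemma dirder_product v (Y : 'rV[R]_(1 + n) -> 'rV[R]_(1 + n))
    (Y' : 'rV[R]_n -> 'rV[R]_n) (a : 'rV[R]_1) x :
  (forall y, Y y = row_mx a (Y' (rsubmx y))) ->
  dirder v Y x = row_mx 0 (dirder (rsubmx v) Y' (rsubmx x)).
Proof.
move=> YE; apply/rowP => k; rewrite mxE; case: (split_ordP k) => j ->.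
  have -> : (fun y => Y y 0 (lshift n j)) = cst (a 0 j).
    by apply/funext => y; rewrite YE row_mxEl.
  by rewrite derive_cst row_mxEl mxE.
have -> : (fun y => Y y 0 (rshift 1 j)) = (fun y => (fun z => Y' z 0 j) (rsubmx y)).
  by apply/funext => y; rewrite YE row_mxEr.
by rewrite (derive_comp_rsubmx (fun z => Y' z 0 j)) row_mxEr mxE.
Qed.

(** The constant [a] serves both levels of the curvature: the time component of a constant field,
    and the 0 left by an inner [nabla]. *)
Lemma nabla_product i (X Y : 'rV[R]_(1 + n) -> 'rV[R]_(1 + n))
    (X' Y' : 'rV[R]_n -> 'rV[R]_n) (a : 'rV[R]_1) x :
  (forall y, rsubmx (X y) = X' (rsubmx y)) ->
  (forall y, Y y = row_mx a (Y' (rsubmx y))) ->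
  nabla (i : chart P) X Y x = row_mx 0 (nabla i X' Y' (rsubmx x)).
Proof.
move=> XE YE; rewrite /nabla (dirder_product _ _ YE) christoffel_product.
by rewrite add_row_mx addr0 XE YE row_mxKr.
Qed.

Lemma riem_product i x u v w : riem (i : chart P) x u v w =
  row_mx 0 (riem i (rsubmx x) (rsubmx u) (rsubmx v) (rsubmx w)).
Proof.
have cstE z y : (cst z : 'rV[R]_(1 + n) -> _) y =
    row_mx (lsubmx z) (cst (rsubmx z) (rsubmx y : 'rV[R]_n)).
  by rewrite /= hsubmxK.
have nablaC z y : nabla (i : chart P) (cst z) (cst w) y =
    row_mx 0 (nabla i (cst (rsubmx z)) (cst (rsubmx w)) (rsubmx y)).
  by apply: nabla_product; [|exact: cstE].
rewrite /riem /curvature_fields !lie_bracket_cst.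
rewrite (nabla_product (X' := cst (rsubmx u)) _ _ _ (nablaC v))//.
rewrite (nabla_product (X' := cst (rsubmx v)) _ _ _ (nablaC u))//.
by rewrite nablaC raddf0 !opp_row_mx !add_row_mx !subr0.
Qed.

End ProductGeometry.

(** * Covariant derivatives and r-tension of the product curve *)

Section ProductCurve.
Variables (R : realType) (n : nat) (M : semi_riemannian R n).
Let P := lorentz_product M.
Variables (alpha : R -> M) (d1 d2 : R).
Let gamma (s : R) : P := (d1 * s, alpha (d2 * s)).
Implicit Types (i : chart M) (V : field_along P) (W : field_along M).

Lemma velocity_product i s : velocity gamma i s =
  row_mx d1%:M (d2 *: velocity alpha i (d2 * s)).
Proof.
apply/rowP => k; rewrite mxE; case: (split_ordP k) => j ->.
  have -> : (fun t => Defs.coord P i (gamma t) 0 (lshift n j)) =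
      (fun t => 1 * id (d1 * t)).
    by apply/funext => t; rewrite row_mxEl mxE ord1 eqxx mulr1n mul1r.
  rewrite (derive1_scale id) row_mxEl mxE ord1 eqxx mulr1n derive1E derive_id.
  by rewrite !mulr1.
have -> : (fun t => Defs.coord P i (gamma t) 0 (rshift 1 j)) =
    (fun t => 1 * (fun t' => Defs.coord M i (alpha t') 0 j) (d2 * t)).
  by apply/funext => t; rewrite row_mxEr mul1r.
rewrite (derive1_scale (fun t => Defs.coord M i (alpha t) 0 j)).
by rewrite row_mxEr !mxE mulr1.
Qed.

(** The constant time component differentiates to 0, and the speed [d2] supplies the new factor. The
    hypothesis is local because a frame field is known only inside a chart domain. *)
Lemma covariant_derivative_product V W i s (a : 'rV[R]_1) (b : R) :
  (\forall t \near s, V i t = row_mx a (b *: W i (d2 * t))) ->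
  covariant_derivative gamma V i s =
  row_mx 0 ((d2 * b) *: covariant_derivative alpha W i (d2 * s)).
Proof.
move=> VE; rewrite /covariant_derivative.
rewrite christoffel_product velocity_product (nbhs_singleton VE).
rewrite !row_mxKr christoffel_scale scalerDr -[0 in RHS]addr0 -add_row_mx.
congr (_ + _); apply/rowP => k; rewrite mxE derive1E.
case: (split_ordP k) => j ->.
  rewrite (near_eq_derive (g := cst (a 0 j))).
    by rewrite derive_cst row_mxEl mxE.
  by apply: filterS VE => t ->; rewrite row_mxEl.
rewrite (near_eq_derive (g := fun t => b * (fun t' => W i t' 0 j) (d2 * t))).
  by rewrite -derive1E (derive1_scale (fun t => W i t 0 j)) row_mxEr !mxE.
by apply: filterS VE => t ->; rewrite row_mxEr mxE.
Qed.

Lemma nablaT_product j i s : nablaT gamma j i s =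
  row_mx (if j is 0 then d1%:M else 0) (d2 ^+ j.+1 *: nablaT alpha j i (d2 * s)).
Proof.
elim: j i s => [|j IH] i s; first by rewrite expr1 -velocity_product.
rewrite [d2 ^+ _]exprS -(covariant_derivative_product (V := nablaT gamma j)
  (a := if j is 0 then d1%:M else 0))//.
by near=> t; rewrite IH.
Unshelve. all: by end_near. Qed.

Lemma r_tension_product r i s : (2 <= r)%N ->
  r_tension gamma r i s = row_mx 0 (d2 ^+ (2 * r) *: r_tension alpha r i (d2 * s)).
Proof.
(* Exhibiting [2r - 1] as a successor selects the zero time component in [nablaT_product]. *)
move=> r2; have [q qE] : exists q, (2 * r - 1 = q.+1)%N by exists (2 * r - 2)%N; lia.
have row0D : {morph (fun u : 'rV[R]_n => row_mx (0 : 'rV[R]_1) u) : u v / u + v}.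
  by move=> u v; rewrite add_row_mx addr0.
rewrite /r_tension scalerDr row0D; congr (_ + _).
  by rewrite qE nablaT_product -qE; congr (row_mx _ (_ ^+ _ *: _)); lia.
rewrite scaler_sumr (big_morph _ row0D (@row_mx0 _ 1 1 n)).
apply: eq_bigr => l _; rewrite riem_product velocity_product !nablaT_product.
rewrite !row_mxKr riem_scale -exprD -exprSr scale_row_mx scaler0 !scalerA mulrC.
(* The exponents add up to [(2r - 3 - l + 1) + (l + 1) + 1 = 2r]; the bound on [l] prevents
   truncated subtraction. *)
by congr (row_mx _ (_ ^+ _ * _ *: _)); have := ltn_ord l; lia.
Qed.

Lemma r_harmonic_product (I : set R) r : 0 < d2 -> (2 <= r)%N ->
  r_harmonic [set s | I (d2 * s)] gamma r <-> r_harmonic I alpha r.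
Proof.
move=> d2_gt0 r2; have d20 := lt0r_neq0 d2_gt0; split=> h i s Is ds.
  (* The point [alpha s] is reached by [gamma] at parameter [d2^-1 * s]. *)
  have sE : d2 * (d2^-1 * s) = s by rewrite mulVKf.
  have Js : I (d2 * (d2^-1 * s)) by rewrite sE.
  have dg : dom P i (gamma (d2^-1 * s)) by rewrite /= /prod_dom /= sE.
  have := h i _ Js dg; rewrite r_tension_product// sE.
  move=> /(congr1 rsubmx); rewrite row_mxKr raddf0.
  by move=> /eqP; rewrite scaler_eq0 expf_eq0 (negPf d20) andbF => /eqP.
by rewrite r_tension_product// h// scaler0 row_mx0.
Qed.

Lemma geodesic_product (I : set R) : 0 < d2 ->
  geodesic [set s | I (d2 * s)] gamma <-> geodesic I alpha.
Proof.
move=> d2_gt0; have d20 := lt0r_neq0 d2_gt0; split=> h i s Is ds.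
  have sE : d2 * (d2^-1 * s) = s by rewrite mulVKf.
  have Js : I (d2 * (d2^-1 * s)) by rewrite sE.
  have dg : dom P i (gamma (d2^-1 * s)) by rewrite /= /prod_dom /= sE.
  have := h i _ Js dg; rewrite nablaT_product// sE.
  move=> /(congr1 rsubmx); rewrite row_mxKr raddf0.
  by move=> /eqP; rewrite scaler_eq0 expf_eq0 (negPf d20) andbF => /eqP.
by rewrite nablaT_product h// scaler0 row_mx0.
Qed.

(** * Curvature and torsion of the product curve *)

Section Frenet.
Variables (o : option (orientation M)) (I : set R) (Na Ba : field_along M).
Variables (ka ta : R) (e1 e2 e3 : R) (Ng Bg : field_along P) (k t : R -> R).
Hypothesis d2_gt0 : 0 < d2.
Hypothesis d2E : d2 ^+ 2 = e1 + d1 ^+ 2.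
Hypothesis alphaF : frenet3 o I alpha 1 1 1 Na Ba (cst ka) (cst ta).
Hypothesis gammaF :
  frenet3 None [set s | I (d2 * s)] gamma e1 e2 e3 Ng Bg k t.

Let curvature_normal_eq i s : I (d2 * s) -> dom M i (alpha (d2 * s)) ->
  (e2 * k s) *: Ng i s = row_mx 0 ((d2 ^+ 2 * ka) *: Na i (d2 * s)).
Proof.
move=> Is ds; have [<- _ _] := frenet_eqs gammaF (i := i) Is ds.
have [TE _ _] := frenet_eqs alphaF Is ds.
rewrite -[covariant_derivative _ _ _ _]/(nablaT gamma 1 i s) nablaT_product.
by rewrite [nablaT _ _ _ _]TE scalerA mul1r.
Qed.

(** Squared norms in [curvature_normal_eq] give [e2 k^2 = (d2^2 ka)^2 > 0], which excludes
    [e2 = -1]; positivity then removes the squares. *)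
Lemma product_curvature s : I (d2 * s) -> e2 = 1 /\ k s = d2 ^+ 2 * ka.
Proof.
move=> Is; have [i ds] := dom_cover (alpha (d2 * s)).
have := congr1 (fun u => inner (i : chart P) (Defs.coord P i (gamma s)) u u)
  (curvature_normal_eq Is ds).
have [_ Ng2 _] := frenet_norm gammaF (i := i) Is ds.
have [_ Na2 _] := frenet_norm alphaF Is ds.
rewrite inner_scale Ng2 inner_product !row_mxKl !row_mxKr mxE mul0r oppr0 add0r.
rewrite inner_scale Na2.
have k0 := frenet_k gammaF Is; have := frenet_k alphaF Is; rewrite /= => ka0.
have kd0 : 0 < d2 ^+ 2 * ka by rewrite mulr_gt0 ?exprn_gt0.
have [_ [->|->] _] := frenet_signs gammaF; last by nra.
move=> kE; split=> //; apply/eqP; rewrite -(@eqrXn2 _ 2)// ?ltW//.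
by apply/eqP; rewrite !expr2; move: kE; rewrite mulr1 !mul1r mulr1.
Qed.

(** The factor 1 is kept to match [covariant_derivative_product] with [b = 1]. *)
Let product_normal i s : I (d2 * s) -> dom M i (alpha (d2 * s)) ->
  Ng i s = row_mx 0 (1 *: Na i (d2 * s)).
Proof.
move=> Is ds; have [e2E kE] := product_curvature Is.
have k0 : k s != 0 by rewrite gt_eqF// (frenet_k gammaF Is).
apply: (scalerI k0); have := curvature_normal_eq Is ds.
by rewrite e2E mul1r -kE => ->; rewrite scale_row_mx scaler0 scale1r.
Qed.

(** Differentiating the normal [(0, Na)] and comparing second Frenet equations isolates [e3 t Bg];
    its squared norm is then computed from the orthonormal pair [T], [B] of [alpha]. *)
Lemma product_torsion s : I (d2 * s) ->
  t s ^+ 2 = d2 ^+ 2 * (e3 * (ta ^+ 2 - e1 * d1 ^+ 2 * ka ^+ 2)).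
Proof.
move=> Is; have [i ds] := dom_cover (alpha (d2 * s)).
have [e2E kE] := product_curvature Is.
(* Differentiation needs the formula for the normal near [s]: both the interval and the chart
   condition are open. *)
have NE : \forall t' \near s, Ng i t' = row_mx 0 (1 *: Na i (d2 * t')).
  have Inear : \forall t' \near s, I (d2 * t').
    have [oI _ _] := frenet_interval gammaF.
    exact: (open_nbhs_nbhs (conj oI Is)).
  have dnear : \forall t' \near s, dom M i (alpha (d2 * t')).
    have [cg _] := frenet_smooth gammaF.
    apply: (cg s Is (dom P i)); apply: open_nbhs_nbhs; split=> //.
    exact: (@dom_open _ _ P i).
  by near=> t'; apply: product_normal; near: t'.
have [_ + _] := frenet_eqs gammaF (i := i) Is ds.
rewrite (covariant_derivative_product NE) velocity_product.
have [_ -> _] := frenet_eqs alphaF Is ds.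
have [Tg2 _ Bg2] := frenet_norm gammaF (i := i) Is ds.
have [Ta2 _ Ba2] := frenet_norm alphaF Is ds.
have [_ TB _] := frenet_orth alphaF Is ds.
set x := Defs.coord M i (alpha (d2 * s)) in Ta2 Ba2 TB *.
set T := velocity alpha i (d2 * s) in Ta2 TB *; set B := Ba i (d2 * s) in Ba2 TB *.
have BT : inner i x B T = 0 by rewrite innerC//; exists (alpha (d2 * s)).
rewrite /= => E.
have : (e3 * t s) *: Bg i s = row_mx (e1 * k s * d1)%:M
    ((d2 * (e1 * k s - ka)) *: T + (d2 * ta) *: B).
  move/(congr1 (fun u => (e1 * k s) *: row_mx d1%:M (d2 *: T) + u)): E.
  rewrite (scaleNr (e1 * k s)) addNKr => <-.
  rewrite scale_row_mx add_row_mx addr0 scale_scalar_mx; congr (row_mx _ _).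
  rewrite !mul1r mulr1 /= scalerDr !scalerA addrA -scalerDl; congr (_ *: _ + _).
  by rewrite /cst; ring.
move=> /(congr1 (fun u => inner (i : chart P) (Defs.coord P i (gamma s)) u u)).
rewrite inner_scale Bg2 inner_product !row_mxKl !row_mxKr mxE eqxx mulr1n -/x.
rewrite innerDl !innerDr !inner_scale TB BT Ta2 Ba2 kE.
have [se1 _ se3] := frenet_signs gammaF.
have <- : e3 * (e3 * t s * (e3 * t s) * e3) = t s ^+ 2 by case: se3 => ->; ring.
move=> ->; apply: (@etrans _ _ (e3 * d2 ^+ 2 * ((e1 * d2 ^+ 2 * ka - ka) ^+ 2
  + ta ^+ 2 - (e1 * d1 * ka) ^+ 2 * d2 ^+ 2))); first by ring.
(* Since [e1^2 = 1], [e1 d2^2 - 1 = e1 d1^2], and the terms in [d1^4] cancel. *)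
by rewrite d2E; case: se1 => ->; ring.
Unshelve. all: by end_near. Qed.

End Frenet.
End ProductCurve.

(** * Transfer of the helix property and r-harmonicity between [gamma] and [alpha] *)

Theorem theorem1p26 (R : realType) (m : nat) (hm : (4 <= m)%N)
    (c : R) (hc : c != 0)
    (N : semi_riemannian R m.-1) (hN : riemannian N) (hNc : constant_curvature N c)
    (oN : option (orientation N))
    (* the 3-Frenet helix alpha, with normal, binormal and constant curvatures *)
    (I : set R) (alpha : R -> N) (Nalpha Balpha : field_along N) (kalpha talpha : R)
    (halpha : frenet3 oN I alpha 1 1 1 Nalpha Balpha (cst kalpha) (cst talpha))
    (e1 e2 e3 d1 d2 : R)
    (hd : 0 < e1 + d1 ^+ 2) (hd2 : d2 = Num.sqrt (e1 + d1 ^+ 2))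
    (J : set R) (hJ : J = [set s | I (d2 * s)])
    (gamma : R -> lorentz_product N)
    (hgamma : gamma = fun s => (d1 * s, alpha (d2 * s)))
    (* the ambient dimension m is not 3, so no orientation intervenes *)
    (Ngamma Bgamma : field_along (lorentz_product N)) (k t : R -> R)
    (hfrenet : frenet3 None J gamma e1 e2 e3 Ngamma Bgamma k t)
    (hpos : 0 < e3 * (talpha ^+ 2 - e1 * d1 ^+ 2 * kalpha ^+ 2)) :
  (helix J k t /\
   forall s, J s -> e1 * k s ^+ 2 + e3 * t s ^+ 2 <> 0) /\
  forall r : nat, (2 <= r)%N ->
    (proper_r_harmonic J gamma r <-> proper_r_harmonic I alpha r).
Proof.
have d2_gt0 : 0 < d2 by rewrite hd2 sqrtr_gt0.
have d2E : d2 ^+ 2 = e1 + d1 ^+ 2 by rewrite hd2 sqr_sqrtr// ltW.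
subst J gamma; split; last first.
  move=> r r2; rewrite /proper_r_harmonic.
  have [rg ra] := @r_harmonic_product _ _ N alpha d1 d2 I r d2_gt0 r2.
  have [gg ga] := @geodesic_product _ _ N alpha d1 d2 I d2_gt0.
  by split=> -[h ng]; split; [exact: rg|move=> /ga|exact: ra|move=> /gg].
have kE s : I (d2 * s) -> k s = d2 ^+ 2 * kalpha.
  by move=> Is; have [] := product_curvature d2_gt0 halpha hfrenet Is.
have tE s := product_torsion d2_gt0 d2E halpha hfrenet (s := s).
have [se1 _ se3] := frenet_signs hfrenet.
split=> [|s Is].
  exists (d2 ^+ 2 * kalpha),
    (d2 * Num.sqrt (e3 * (talpha ^+ 2 - e1 * d1 ^+ 2 * kalpha ^+ 2))) => s Is.
  split; first exact: kE.
  (* Without an orientation the torsion is positive, so it is the positive root of the constant in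
     [product_torsion]. *)
  have t_gt0 : 0 < t s by exact: (frenet_t hfrenet).
  apply/eqP; rewrite -(@eqrXn2 _ 2)// ?(ltW t_gt0) ?mulr_ge0 ?sqrtr_ge0 ?(ltW d2_gt0)//.
  by rewrite exprMn sqr_sqrtr ?(ltW hpos)// tE.
have ka_gt0 : 0 < kalpha by exact: (frenet_k halpha Is).
apply/eqP; rewrite kE// tE//.
have -> : e1 * (d2 ^+ 2 * kalpha) ^+ 2
    + e3 * (d2 ^+ 2 * (e3 * (talpha ^+ 2 - e1 * d1 ^+ 2 * kalpha ^+ 2)))
    = d2 ^+ 2 * (kalpha ^+ 2 + talpha ^+ 2).
  apply: (@etrans _ _ (d2 ^+ 2 * (e1 * d2 ^+ 2 * kalpha ^+ 2
    + e3 ^+ 2 * (talpha ^+ 2 - e1 * d1 ^+ 2 * kalpha ^+ 2)))); first by ring.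
  (* Only the inner [d2^2] is expanded: [e1 d2^2 = 1 + e1 d1^2] cancels the mixed term. *)
  by rewrite [X in e1 * X]d2E; case: se1 => ->; case: se3 => ->; ring.
by rewrite gt_eqF// mulr_gt0 ?exprn_gt0// ltr_wpDr ?sqr_ge0 ?exprn_gt0.
Qed.
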